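(* Fix integers $d\geq1$, $k\geq 2$ and a point $x^0\in[0,1)^d$, and use the notation below. Let $q \in \beta \mathbb{N}_0$ be a minimal idempotent, $p \in \beta \mathbb{N}_0+q$, and let $S \subset [0,1)^d$ be semialgebraic. Suppose that $x^q = x^0$ and that $x^n \in S$ for $p$-almost all $n$. Then the set of $l \in \mathbb{N}$ such that $\{l x^0\} \in S$ is $\mathrm{IP}^*_+$.
   Context: $\{y\}$ is the coordinatewise fractional part. $\beta\mathbb{N}_0$ is the space of ultrafilters on $\mathbb{N}_0$ with addition $E\in p+q$ iff $\{n:\{m:n+m\in E\}\in q\}\in p$; $q$ is idempotent if $q+q=q$ and minimal if $\beta\mathbb{N}_0+q$ is a minimal left ideal. Put $x^n:=\{k^nx^0\}$ for $n\in\mathbb{N}_0$ and $x^p:=\lim_{n\to p}x^n$. ''$p$-almost all $n$'' means the set of such $n$ lies in $p$. A semialgebraic set is a finite union of sets defined by finitely many polynomial equations and strict polynomial inequalities. A set is $\mathrm{IP}$ if it contains all finite nonempty sums of some sequence in $\mathbb{N}$, $\mathrm{IP}^*$ if it meets every $\mathrm{IP}$ set, $\mathrm{IP}^*_+$ if some translate of it is $\mathrm{IP}^*$. *)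

(* Defs.v *)
From mathcomp Require Import all_boot all_order all_algebra.
From mathcomp Require Import finmap.
From mathcomp Require Import all_classical all_reals all_analysis.
(* The notations of mpoly clash with those of analysis. *)
From mathcomp Require Import -(notations) mpoly.

Set Implicit Arguments.
Unset Strict Implicit.
Unset Printing Implicit Defensive.

Import Order.TTheory GRing.Theory Num.Theory.
Import numFieldNormedType.Exports.

Local Open Scope classical_set_scope.
Local Open Scope ring_scope.

Lemma ultra_setVsetC T (F : set_system T) :
  ProperFilter F -> (forall A, F A \/ F (~` A)) -> UltraFilter F.
Proof.
move=> PF FC; split=> // G GF sG; rewrite eqEsubset; split=> // A GA.
have [//|/sG GnA] := FC A.
by have [x []] := filter_ex (filterI GA GnA).
Qed.

(* The points of beta N_0; principal ultrafilters are included. *)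
Record betaN := BetaN {
  betaN_sets : set_system nat;
  betaN_ultra : UltraFilter betaN_sets }.
#[global] Existing Instance betaN_ultra.

Lemma betaN_ext (p q : betaN) :
  (forall E, betaN_sets p E <-> betaN_sets q E) -> p = q.
Proof.
case: p q => [p pU] [q qU] /= pq.
have e : p = q by apply/funext => E; exact/propext.
by subst q; congr BetaN; exact: Prop_irrelevance.
Qed.

Section addition.
Variables p q : betaN.

Definition betaN_add_sets : set_system nat :=
  [set E | \forall n \near betaN_sets p,
             \forall m \near betaN_sets q, E (n + m)%N].

Lemma betaN_add_ultra : UltraFilter betaN_add_sets.
Proof.
have FF : Filter betaN_add_sets.
  split.
  - by apply: (@filterE _ (betaN_sets p)) => n; exact: filterT.
  - move=> A B; apply: (@filterS2 _ (betaN_sets p)) => n.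
    exact: (@filterS2 _ (betaN_sets q)).
  - move=> A B AB; apply: (@filterS _ (betaN_sets p)) => n.
    by apply: (@filterS _ (betaN_sets q)) => m; exact: AB.
have PF : ProperFilter betaN_add_sets.
  apply: Build_ProperFilter_ex => E pE.
  have [n qE] := @filter_ex _ (betaN_sets p) _ _ pE.
  by have [m Em] := @filter_ex _ (betaN_sets q) _ _ qE; exists (n + m)%N.
apply: ultra_setVsetC => E.
pose Ep : set nat := [set n | \forall m \near betaN_sets q, E (n + m)%N].
have [|nE] := in_ultra_setVsetC Ep (betaN_ultra p); first by left.
right; apply: (@filterS _ (betaN_sets p)) nE => n /= nqE.
by have [|] := in_ultra_setVsetC [set m | E (n + m)%N] (betaN_ultra q).
Qed.

Definition betaN_add : betaN := BetaN betaN_add_ultra.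

End addition.

Definition idempotent_ultrafilter (q : betaN) : Prop := betaN_add q q = q.

Definition left_ideal (L : set betaN) : Prop :=
  L !=set0 /\ forall p l, L l -> L (betaN_add p l).

Definition minimal_left_ideal (L : set betaN) : Prop :=
  left_ideal L /\ forall L', left_ideal L' -> L' `<=` L -> L' = L.

Definition betaN_translate (q : betaN) : set betaN :=
  [set betaN_add r q | r in setT].

Definition minimal_ultrafilter (q : betaN) : Prop :=
  minimal_left_ideal (betaN_translate q).

Section orbits.
Variables (R : realType) (d : nat).

Definition unit_cube : set 'rV[R]_d := [set y | forall i, 0 <= y 0 i < 1].

Definition frac_part (y : 'rV[R]_d) : 'rV[R]_d :=
  map_mx (fun t : R => t - (Num.floor t)%:~R) y.

Definition kpow_orbit (k : nat) (x0 : 'rV[R]_d) (n : nat) : 'rV[R]_d :=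
  frac_part ((k ^ n)%N%:R *: x0).

(* The limit is taken in R^d, where it always exists (kpow_orbit_is_cvg) but may
   leave [0,1)^d. For x0 in [0,1)^d, having limit x0 means the same as in the
   torus: a coordinate of x0 is either in ]0,1[ or 0, and in the latter case
   that coordinate vanishes along the whole orbit. *)
Definition kpow_orbit_lim (k : nat) (x0 : 'rV[R]_d) (p : betaN) : 'rV[R]_d :=
  lim (kpow_orbit k x0 @ betaN_sets p).

Lemma frac_part_unit_cube y : unit_cube (frac_part y).
Proof.
move=> i; rewrite !mxE subr_ge0 floor_le ltrBlDl.
by rewrite -{2}[1]/(1%:~R) -intrD floorD1_gt.
Qed.

Lemma kpow_orbit_is_cvg k x0 (p : betaN) : cvg (kpow_orbit k x0 @ betaN_sets p).
Proof.
pose C : set 'rV[R]_d := [set v | forall i, `[0, 1]%classic (v 0 i)].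
have Cc : compact C.
  by apply: (@rV_compact R d (fun=> `[0, 1]%classic)) => i;
    exact: segment_compact.
have pC : (kpow_orbit k x0 @ betaN_sets p) C.
  apply: (@filterE _ (betaN_sets p)) => n i /=; rewrite in_itv /=.
  by have /andP[-> /ltW ->] := frac_part_unit_cube ((k ^ n)%N%:R *: x0) i.
have orbitU : UltraFilter (kpow_orbit k x0 @ betaN_sets p).
  apply: ultra_setVsetC => A.
  exact: in_ultra_setVsetC (kpow_orbit k x0 @^-1` A) (betaN_ultra p).
move: Cc; rewrite compact_ultra => /(_ _ orbitU pC)[y [_ cvy]].
by apply/cvg_ex; exists y.
Qed.

(* For c = (E, P): f = 0 for all f in E and g > 0 for all g in P. *)
Definition basic_semialgebraic (c : seq (mpoly d R) * seq (mpoly d R)) :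
    set 'rV[R]_d :=
  [set y | (forall f, f \in c.1 -> meval (fun i => y 0 i) f = 0) /\
           (forall g, g \in c.2 -> 0 < meval (fun i => y 0 i) g)].

Definition semialgebraic (S : set 'rV[R]_d) : Prop :=
  exists cs : seq (seq (mpoly d R) * seq (mpoly d R)),
    S = [set y | exists2 c, c \in cs & basic_semialgebraic c y].

End orbits.

Arguments unit_cube : clear implicits.

(* N = {1, 2, ...}: the generators of an IP set are positive. *)
Definition finite_sums (a : nat -> nat) : set nat :=
  [set (\sum_(i <- F) a i)%N | F in [set F : {fset nat} | F != fset0]].

Definition IP (A : set nat) : Prop :=
  exists2 a : nat -> nat, (forall i, 0 < a i)%N & finite_sums a `<=` A.

Definition IP_star (A : set nat) : Prop :=
  forall B, IP B -> A `&` B !=set0.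

(* Translates are taken in Z, in either direction, and then cut down to the
   naturals. *)
Definition translate_set (t : int) (A : set nat) : set nat :=
  [set n | exists2 m, A m & n%:Z = m%:Z + t].

Definition IP_star_plus (A : set nat) : Prop :=
  exists t : int, IP_star (translate_set t A).

(* Main.v *)
Require Import Defs.
From mathcomp Require Import all_boot all_order all_algebra.
From mathcomp Require Import finmap.
From mathcomp Require Import all_classical all_reals all_analysis.
From mathcomp Require Import -(notations) mpoly.
From mathcomp Require Import ring lra zify.

(** Put [delta b = x^b - x^0], which tends to [0] along [q]; idempotence gives
    [delta (b + c) = delta b + k^b delta c] for q-almost all [b], then
    q-almost all [c]. Let [L] be the least linear subspace containing q-almost
    all [delta b].

    [L] is the Zariski closure of the [delta b]: this closure [Z] (in bounded
    degree) is stable under the homotheties [y |-> delta b + k^b y], hence is a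
    cone about their centres [- delta b / (k^b - 1)]. The centres tend to [0],
    so [Z] is also a cone about [0], therefore stable under translation by
    every centre, and contains [L]. So a polynomial vanishing at
    [z + k^a delta b] for q-almost all [b] vanishes on [z + L], while strict
    inequalities are open: some point [x^n] of [S] is interior to [S] relative
    to [x^n + L].

    The points [x^0 - delta b / (k^b - 1)] are rational, tend to [x^0] and
    differ by elements of [L]; so [x^0] lies in a rational translate of a
    rational subspace of [L]. By discreteness, [m x^0 - N] lies in [L] as soon
    as it is small, for [N] integral. By the pigeonhole principle every IP set
    contains such an [m], and then [{(k^n + m) x^0} = x^n + (m x^0 - N)] is in
    [S]. *)

Set Implicit Arguments.
Unset Strict Implicit.
Unset Printing Implicit Defensive.

Import Order.TTheory GRing.Theory Num.Theory.
Import numFieldNormedType.Exports.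

Local Open Scope classical_set_scope.
Local Open Scope ring_scope.

(** * Linear hulls along a filter *)

(** A candidate of least rank is the least one: its intersection with any other candidate is again a
    candidate, so has the same rank. *)
Lemma filter_hull (K : fieldType) (n : nat) (F : set_system nat) (FF : Filter F)
    (phi : nat -> 'rV[K]_n) :
  exists A : 'M[K]_n, F [set c | (phi c <= A)%MS] /\
    forall B : 'M[K]_n, F [set c | (phi c <= B)%MS] -> (A <= B)%MS.
Proof.
pose P r := `[< exists2 A : 'M[K]_n, \rank A = r & F [set c | (phi c <= A)%MS] >].
have exP : exists r, P r.
  exists (\rank (1%:M : 'M[K]_n)); apply/asboolP; exists 1%:M => //.
  by apply: (@filterE _ F) => c /=; exact: submx1.
case: (ex_minnP exP) => r /asboolP[A rA FA] minr.
exists A; split => // B FB.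
have le_r : (r <= \rank (A :&: B)%MS)%N.
  apply: minr; apply/asboolP; exists (A :&: B)%MS => //.
  by apply: filterS2 FA FB => c /= cA cB; rewrite sub_capmx cA.
have [_] := mxrank_leqif_sup (capmxSl A B).
rewrite sub_capmx submx_refl /= => <-.
by rewrite eqn_leq mxrankS ?capmxSl //= rA.
Qed.

(** Take a largest free family of rows from [E]. Since the rows are in [E], properties of its
    elements pass to a basis of the span. *)
Lemma span_of_set (K : fieldType) (n : nat) (E : set 'rV[K]_n) :
  exists r, exists A : 'M[K]_(r, n), [/\ (r <= n)%N, forall i, E (row i A) &
    forall v, E v -> (v <= A)%MS].
Proof.
pose P r := `[< exists2 A : 'M[K]_(r, n), row_free A & forall i, E (row i A) >].
have exP : exists r, P r.
  exists 0%N; apply/asboolP; exists 0 => [|[]//].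
  by rewrite -row_leq_rank.
have ubP r : P r -> (r <= n)%N.
  by move=> /asboolP[A /eqP rA _]; have := rank_leq_col A; rewrite rA.
case: (ex_maxnP exP ubP) => r /asboolP[A fA EA] maxr.
exists r, A; split=> // [|v Ev].
  by apply: ubP; apply/asboolP; exists A.
have [//|nvA] := boolP (v <= A)%MS.
suff: (1 + r <= r)%N by rewrite ltnn.
apply: maxr; apply/asboolP; exists (col_mx v A) => [|i]; last first.
  case: (splitP i) => j ij.
    have -> : i = lshift r j by exact: val_inj.
    by rewrite rowKu row_id.
  have -> : i = rshift 1 j by exact: val_inj.
  by rewrite rowKd.
rewrite -row_leq_rank -addsmxE add1n; 
have [le_A eq_A] := mxrank_leqif_sup (addsmxSr v A).
rewrite (eqP fA) in le_A eq_A.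
by rewrite ltn_neqAle le_A andbT eq_A addsmx_sub (negPf nvA).
Qed.

(** * Polynomials of bounded degree as linear functionals *)

Section BoxMonomials.
Variables (R : realType) (d : nat).
Implicit Types (D : nat) (u v y : 'rV[R]_d).

Definition box_degrees D (j : 'I_#|{ffun 'I_d -> 'I_D}|) : {ffun 'I_d -> 'I_D} :=
  enum_val j.

(** A column [w] encodes a polynomial, with value [box_monomials D y *m w] at [y]. Bounding each
    degree separately lets substitutions expand coordinate by coordinate. *)
Definition box_monomials D y : 'rV[R]_#|{ffun 'I_d -> 'I_D}| :=
  \row_j \prod_i y 0 i ^+ box_degrees j i.

Lemma box_monomials_homothety D v (a : R) :
  exists Theta : 'M[R]_#|{ffun 'I_d -> 'I_D}|,
    forall y, box_monomials D (v + a *: y) = box_monomials D y *m Theta.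
Proof.
(* [c i m j] is the coefficient of [y 0 i ^+ j] in [(v 0 i + a * y 0 i) ^+ m]. *)
pose c (i : 'I_d) (m j : 'I_D) : R :=
  if (j < m.+1)%N then v 0 i ^+ (m - j) * a ^+ j *+ 'C(m, j) else 0.
exists (\matrix_(t, s) \prod_i c i (box_degrees s i) (box_degrees t i)) => y.
apply/rowP => s; rewrite !mxE.
transitivity (\prod_i \sum_(j < D) c i (box_degrees s i) j * y 0 i ^+ j).
  apply: eq_bigr => i _; rewrite !mxE exprDn.
  rewrite (big_ord_widen D (fun j => v 0 i ^+ (box_degrees s i - j) *
    (a * y 0 i) ^+ j *+ 'C(box_degrees s i, j))) // big_mkcond.
  apply: eq_bigr => j _; rewrite /c; case: ifP => _; last by rewrite mul0r.
  by rewrite exprMn mulrA mulrnAl.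
rewrite bigA_distr_bigA.
under [RHS]eq_bigr => t _ do rewrite !mxE mulrC -big_split /=.
by rewrite [LHS](big_enum_val (A := predT)).
Qed.

Lemma box_monomials_line D u v (w : 'cV[R]_#|{ffun 'I_d -> 'I_D}|) :
  exists p : {poly R}, forall s : R, p.[s] = (box_monomials D (u + s *: v) *m w) 0 0.
Proof.
exists (\sum_j w j 0 *: \prod_i ((u 0 i)%:P + v 0 i *: 'X) ^+ box_degrees j i) => s.
rewrite !mxE horner_sum; apply: eq_bigr => j _; rewrite !mxE hornerZ mulrC.
rewrite horner_prod; congr (_ * _); apply: eq_bigr => i _.
by rewrite !mxE !hornerE mulrC.
Qed.

Lemma box_monomials_continuous D (w : 'cV[R]_#|{ffun 'I_d -> 'I_D}|) :
  continuous (fun y => (box_monomials D y *m w) 0 0).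
Proof.
have -> : (fun y => (box_monomials D y *m w) 0 0) =
    fun y => \sum_j (\prod_i y 0 i ^+ box_degrees j i) * w j 0.
  by apply/funext => y; rewrite mxE; apply: eq_bigr => j _; rewrite mxE.
move=> y.
apply: (@cvg_big _ _ _ _ _ add_continuous _ (nbhs y) _ _ _ (nbhs_filter y)) => j _.
apply: (@cvgMr_tmp _ _ (nbhs y) (nbhs_filter y)).
apply: (@cvg_big _ _ _ _ _ mul_continuous _ (nbhs y) _ _ _ (nbhs_filter y)) => i _.
apply: (@continuous_comp _ _ _ (fun z : 'rV[R]_d => z 0 i)
  (fun t : R => t ^+ box_degrees j i) y).
  exact: coord_continuous.
exact: exprn_continuous.
Qed.

Lemma meval_box_monomials (f : mpoly d R) : exists D (w : 'cV[R]_#|{ffun 'I_d -> 'I_D}|),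
  forall y, meval (fun i => y 0 i) f = (box_monomials D y *m w) 0 0.
Proof.
pose D := (msize f).+1.
exists D.
pose ix (m : multinom d) : {ffun 'I_d -> 'I_D} := [ffun i => inord (m i)].
exists (\sum_(m <- msupp f) mcoeff m f *: delta_mx (enum_rank (ix m)) 0) => y.
rewrite mevalE mulmx_sumr summxE big_seq [RHS]big_seq; apply: eq_bigr => m fm.
rewrite -scalemxAr -colE !mxE /box_degrees enum_rankK; congr (_ * _).
apply: eq_bigr => i _; rewrite ffunE inordK // ltnS.
apply: leq_trans (ltnW (msize_mdeg_lt fm)); rewrite mdegE (bigD1 i) //=.
exact: leq_addr.
Qed.
End BoxMonomials.

Definition entries_lt (R : realType) (d : nat) (e : R) (v : 'rV[R]_d) : Prop :=
  forall i, `|v 0 i| < e.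

Lemma nbhs_entries_lt (R : realType) (d : nat) (y : 'rV[R]_d) (U : set 'rV[R]_d) :
  nbhs y U -> exists2 e : R, 0 < e & forall v, entries_lt e v -> U (y + v).
Proof.
move/nbhs_ballP => [e /= e0 yU]; exists e => // v ve; apply: yU.
split=> // i j; rewrite !mxE /ball /= opprD addNKr normrN.
by rewrite (ord1 i).
Qed.

(** * Zariski closure of the vectors [delta b] *)

Section ZariskiHull.
Variables (R : realType) (d : nat) (F : set_system nat).
Context {FF : ProperFilter F}.
Variables (delta : nat -> 'rV[R]_d) (kappa : nat -> R).
Hypothesis FD : forall E : set nat, F E ->
  \forall b \near F, \forall c \near F, E (b + c)%N.
Hypothesis kappa_ge2 : \forall b \near F, 2 <= kappa b.
Hypothesis deltaD : \forall b \near F, \forall c \near F,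
  delta (b + c)%N = delta b + kappa b *: delta c.
Hypothesis delta_small : forall e : R, 0 < e -> \forall b \near F, entries_lt e (delta b).

Section Closure.
Variables (D : nat) (Lambda : 'M[R]_#|{ffun 'I_d -> 'I_D}|).
Hypothesis LambdaF : F [set c | (box_monomials D (delta c) <= Lambda)%MS].
Hypothesis Lambda_min : forall (B : 'M[R]_#|{ffun 'I_d -> 'I_D}|),
  F [set c | (box_monomials D (delta c) <= B)%MS] -> (Lambda <= B)%MS.

(* When [Lambda] is minimal, [Z] is the common zero set of the polynomials of
   degree less than [D] in each variable that vanish at F-almost all [delta c]. *)
Let Z (y : 'rV[R]_d) := (box_monomials D y <= Lambda)%MS.

Let ZP y : (forall (w : 'cV[R]_#|{ffun 'I_d -> 'I_D}|), Lambda *m w = 0 ->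
  (box_monomials D y *m w) 0 0 = 0) -> Z y.
Proof.
move=> h; rewrite /Z submxE; apply/eqP/rowP => j; rewrite [RHS]mxE.
rewrite -[RHS](h (col j (cokermx Lambda))).
  by rewrite !mxE; apply: eq_bigr => i _; rewrite !mxE.
by rewrite colE mulmxA mulmx_coker mul0mx.
Qed.

Let Z0P y (w : 'cV[R]_#|{ffun 'I_d -> 'I_D}|) :
  Z y -> Lambda *m w = 0 -> (box_monomials D y *m w) 0 0 = 0.
Proof. by move=> /submxP[x ->] Lw; rewrite -mulmxA Lw mulmx0 mxE. Qed.

(** As [delta b + kappa b *: delta c] is [delta (b + c)], the preimage of [Lambda] under [H]
    contains the monomials of almost all [delta c], hence contains [Lambda] by minimality. *)
Let Z_homothety : \forall b \near F, forall y, Z y -> Z (delta b + kappa b *: y).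
Proof.
apply: filterS2 (FD LambdaF) deltaD => b /= FZ Fd y Zy.
have [H HE] := box_monomials_homothety D (delta b) (kappa b).
rewrite /Z HE submxE -mulmxA; apply/eqP.
apply/sub_kermxP; apply: submx_trans Zy _; apply: Lambda_min.
apply: filterS2 FZ Fd => c /= + dE; rewrite dE HE submxE -mulmxA => /eqP ?.
exact/sub_kermxP.
Qed.

Let centre b := - (kappa b - 1)^-1 *: delta b.

Let Z_cone : \forall b \near F, forall y s, Z y ->
  Z (centre b + s *: (y - centre b)).
Proof.
apply: filterS2 Z_homothety kappa_ge2 => b ZT k2 y s Zy; set c := centre b.
have k0 : kappa b - 1 != 0 by rewrite gt_eqF // subr_gt0 (lt_le_trans _ k2) ?ltr1n.
have dE : delta b = (1 - kappa b) *: c.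
  by rewrite scalerA mulrN -mulNr opprB mulfV // scale1r.
have Zn n : Z (c + kappa b ^+ n *: (y - c)).
  elim: n => [|n /ZT]; first by rewrite expr0 scale1r addrC subrK.
  congr Z; rewrite dE exprS scalerDr scalerA addrA; congr (_ + _).
  by rewrite -scalerDl subrK scale1r.
(* On a line through the centre, a polynomial vanishing on [Z] has the
   infinitely many roots [kappa b ^+ n]. *)
apply: ZP => w Lw; have [p pE] := box_monomials_line c (y - c) w.
rewrite -pE; suff -> : p = 0 by rewrite horner0.
apply/eqP/negPn/negP => p0.
pose rs := [seq kappa b ^+ i | i <- iota 0 (size p)].
have := @max_poly_roots _ p rs p0; rewrite size_map size_iota ltnn => h.
suff: false by []; apply: h.
  by apply/allP => _ /mapP[n _ ->]; apply/rootP; rewrite pE Z0P.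
rewrite map_inj_uniq ?iota_uniq //; apply: ieexprIn.
  by rewrite (lt_le_trans _ k2).
by rewrite gt_eqF // (lt_le_trans _ k2) ?ltr1n.
Qed.

(** A polynomial vanishing on [Z] but not at [s *: y] would be nonzero nearby, in particular at the
    image of [y] under scaling about a small centre, a point of [Z]. *)
Let Z_scale y s : Z y -> Z (s *: y).
Proof.
move=> Zy; apply: ZP => w Lw; apply/eqP/negPn/negP => g0.
have := @box_monomials_continuous R d D w (s *: y).
move=> /(_ _ (open_nbhs_nbhs (conj (@open_neq _ 0) g0))).
move=> /nbhs_entries_lt[e e0 eU].
(* The displacement is [(1 - s) *: centre b], and [centre b] is no larger than [delta b] because
   [1 <= kappa b - 1]. *)
have e1 : 0 < e / (1 + `|1 - s|) by rewrite divr_gt0 // ltr_pwDl.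
have [b [[Zc k2] db]] := filter_ex (filterI (filterI Z_cone kappa_ge2) (delta_small e1)).
have := Z0P (Zc y s Zy) Lw; set c := centre b.
have -> : c + s *: (y - c) = s *: y + (1 - s) *: c.
  by rewrite scalerBr scalerBl scale1r addrCA addrA.
apply/eqP; apply: eU => i; rewrite mxE normrM mxE normrM normrN.
have k1 : `|(kappa b - 1)^-1| <= 1.
  have k0 : 0 < kappa b - 1 by move: k2; lra.
  by rewrite normfV (gtr0_norm k0) invf_le1 //; move: k2; lra.
have dbi : `|delta b 0 i| * (1 + `|1 - s|) < e by rewrite -ltr_pdivlMr ?db // ltr_pwDl.
apply: le_lt_trans dbi; rewrite mulrC ler_pM ?mulr_ge0 //; last by rewrite lerDr.
by rewrite ler_piMl.
Qed.

Let Z_translate : \forall b \near F, forall y t, Z y -> Z (y + t *: delta b).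
Proof.
apply: filterS2 Z_cone kappa_ge2 => b Zc k2 y t Zy.
have [-> |t0] := eqVneq t 0; first by rewrite scale0r addr0.
have k0 : kappa b - 1 != 0 by rewrite gt_eqF // subr_gt0 (lt_le_trans _ k2) ?ltr1n.
(* Halving [2 *: (s *: y)] towards the centre adds half the centre to [s *: y]; [s] is chosen so
   that rescaling by [s^-1] turns this half into [t *: delta b]. *)
pose s := - (2 * t * (kappa b - 1))^-1.
have := Z_scale s^-1 (Zc (2 *: (s *: y)) 2^-1 (Z_scale 2 (Z_scale s Zy))).
congr Z; apply/rowP => i; rewrite !mxE /s -[2%N]/(2%N).
by field; rewrite t0 k0.
Qed.

(** By minimality, [A] lies in the span of those [delta b] along which [Z] is translation invariant.
    Starting from [0] in [Z], their multiples are added one at a time. *)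
Lemma hull_sub_closure (A : 'M[R]_d) :
  (forall B : 'M[R]_d, F [set c | (delta c <= B)%MS] -> (A <= B)%MS) ->
  forall u : 'rV_d, (u <= A)%MS -> (box_monomials D u <= Lambda)%MS.
Proof.
move=> minA u uA; rewrite -/(Z u).
pose E := [set delta b | b in [set b | forall y t, Z y -> Z (y + t *: delta b)]].
have [r [M [_ ME EM]]] := span_of_set E.
have : (u <= M)%MS.
  rewrite -(genmxE M); apply: submx_trans uA _; apply: minA.
  by apply: filterS Z_translate => b Zb; rewrite /= genmxE; apply: EM; exists b.
move=> /submxP[x ->]; rewrite mulmx_sum_row.
elim: (index_enum _) => [|i s IHs].
  have [c Zc] := filter_ex LambdaF.
  by rewrite big_nil -(scale0r (delta c)); exact: Z_scale.
rewrite big_cons addrC; have [b Zb <-] := ME i; exact: Zb.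
Qed.

End Closure.

(** Substituting [z + a *: y] gives a functional on the same monomials. It kills those of almost all
    [delta c], hence [Lambda], hence those of every vector of [A]. *)
Lemma vanishing_on_hull (A : 'M[R]_d)
    (minA : forall B : 'M[R]_d, F [set c | (delta c <= B)%MS] -> (A <= B)%MS)
    (f : mpoly d R) (z : 'rV[R]_d) (a : R)
    (Ff : \forall c \near F, meval (fun i => (z + a *: delta c) 0 i) f = 0)
    (u : 'rV[R]_d) :
  (u <= A)%MS -> meval (fun i => (z + a *: u) 0 i) f = 0.
Proof.
move=> uA; have [D [w fE]] := meval_box_monomials f.
have [H HE] := box_monomials_homothety D z a.
have [Lambda [LambdaF Lambda_min]] :=
  @filter_hull R _ F _ (fun c => box_monomials D (delta c)).
have : (box_monomials D u <= kermx (H *m w))%MS.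
  apply: submx_trans (Lambda_min _ _).
    exact: (hull_sub_closure LambdaF Lambda_min minA).
  apply: filterS Ff => c /=; rewrite fE HE -mulmxA => fc; apply/sub_kermxP.
  by apply/matrixP => i j; rewrite !ord1 fc mxE.
by move=> /sub_kermxP uw; rewrite fE HE -mulmxA uw mxE.
Qed.
End ZariskiHull.

(** * Rational subspaces and discreteness *)

Lemma mulmx_entries_lt (R : realType) (d m : nat) (C : 'M[R]_(d, m)) (e : R) :
  0 < e -> exists2 e' : R, 0 < e' &
    forall u : 'rV_d, entries_lt e' u -> entries_lt e (u *m C).
Proof.
move=> e0; pose s := \sum_i \sum_j `|C i j|.
have s0 : 0 <= s by rewrite !sumr_ge0 // => i _; rewrite sumr_ge0.
exists (e / (1 + s)); first by rewrite divr_gt0 // ltr_pwDl.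
move=> u ue j; rewrite mxE.
apply: (@le_lt_trans _ _ (e / (1 + s) * s)); last first.
  by rewrite mulrAC ltr_pdivrMr ?ltr_pwDl // ltr_pM2l // ltrDr.
apply: le_trans (ler_norm_sum _ _ _) _; rewrite mulr_sumr ler_sum // => i _.
rewrite normrM ler_pM //; first by rewrite ltW // ue.
by rewrite (bigD1 j) //= lerDl sumr_ge0.
Qed.

Lemma ratr_mx_denominator (R : realType) (m n : nat) (Q : 'M[rat]_(m, n)) :
  exists2 k : nat, (0 < k)%N & k%:R *: map_mx (@ratr R) Q \is a mxOver Num.int.
Proof.
pose D := \prod_(p : 'I_m * 'I_n) denq (Q p.1 p.2).
have D0 : 0 < D by apply: prodr_gt0 => p _; exact: denq_gt0.
exists `|D|%N; first by rewrite absz_gt0 gt_eqF.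
apply/mxOverP => i j; rewrite !mxE.
have -> : `|D|%N%:R = D%:~R :> R by rewrite -[in RHS](gez0_abs (ltW D0)).
rewrite /D (bigD1 (i, j)) //= intrM mulrAC rpredM //; last exact: intr_int.
have dq0 : (denq (Q i j))%:~R != 0 :> R by rewrite intr_eq0 denq_neq0.
by rewrite /ratr mulrC mulfVK // intr_int.
Qed.

Lemma mxOver_int_ratr (R : realType) (m n : nat) (N : 'M[R]_(m, n)) :
  N \is a mxOver Num.int -> exists Q : 'M[rat]_(m, n), N = map_mx ratr Q.
Proof.
move=> /mxOverP Nint; exists (map_mx (fun x => (Num.floor x)%:~R) N).
apply/matrixP => i j; rewrite !mxE ratr_int.
by apply/esym/eqP; rewrite -intrEfloor; exact: Nint.
Qed.

Lemma mxOver_intB (R : realType) (m n : nat) (M N : 'M[R]_(m, n)) :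
  M \is a mxOver Num.int -> N \is a mxOver Num.int -> M - N \is a mxOver Num.int.
Proof.
by move=> /mxOverP Mi /mxOverP Ni; apply/mxOverP => i j; rewrite !mxE rpredB.
Qed.

Lemma mxOver_intD (R : realType) (m n : nat) (M N : 'M[R]_(m, n)) :
  M \is a mxOver Num.int -> N \is a mxOver Num.int -> M + N \is a mxOver Num.int.
Proof.
by move=> /mxOverP Mi /mxOverP Ni; apply/mxOverP => i j; rewrite !mxE rpredD.
Qed.

Lemma int_norm_lt1 (R : archiRealDomainType) (x : R) :
  x \is a Num.int -> `|x| < 1 -> x = 0.
Proof.
move=> /intrP[n ->]; rewrite -intr_norm -[1]/(1%:~R) ltr_int => n1.
by have -> : n = 0 by lia.
Qed.

Lemma small_return_in_hull (R : realType) (d : nat) (F : set_system nat)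
    {FF : ProperFilter F} (x0 : 'rV[R]_d) (delta : nat -> 'rV[R]_d)
    (kappa : nat -> R) (A : 'M[R]_d) :
    (\forall b \near F, 2 <= kappa b) ->
    (\forall b \near F, kappa b \is a Num.int) ->
    (\forall b \near F, (kappa b - 1) *: x0 - delta b \is a mxOver Num.int) ->
    (forall e : R, 0 < e -> \forall b \near F, entries_lt e (delta b)) ->
    (\forall b \near F, (delta b <= A)%MS) ->
  exists2 e : R, 0 < e & forall (n : nat) (N : 'rV[R]_d),
    N \is a mxOver Num.int -> entries_lt e (n%:R *: x0 - N) ->
    (n%:R *: x0 - N <= A)%MS.
Proof.
move=> k2 kint dint dsmall dA.
pose E := [set v : 'rV[R]_d | (v <= A)%MS /\ exists Q : 'rV[rat]_d, v = map_mx ratr Q].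
have [r [M [_ ME EM]]] := span_of_set E.
have MA : (M <= A)%MS by apply/row_subP => i; have [] := ME i.
have [Q MQ] : exists Q : 'M[rat]_(r, d), M = map_mx ratr Q.
  have /choice[Q QE] i : exists Q : 'rV[rat]_d, row i M = map_mx ratr Q.
    by have [] := ME i.
  exists (\matrix_i Q i); apply/row_matrixP => i.
  by rewrite -map_row rowK.
(* For almost all [b] this is an integral vector divided by an integer, hence rational. *)
pose w b := (kappa b - 1)^-1 *: ((kappa b - 1) *: x0 - delta b).
have wE b : 2 <= kappa b -> x0 - w b = (kappa b - 1)^-1 *: delta b.
  move=> kb; rewrite /w scalerBr scalerA mulVf ?scale1r ?subKr //.
  by apply/eqP; move: kb; lra.
have wQ b : kappa b \is a Num.int -> (kappa b - 1) *: x0 - delta b \is a mxOver Num.int ->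
    exists Q : 'rV[rat]_d, w b = map_mx ratr Q.
  move=> /intrP[n kn] /mxOver_int_ratr[q qE]; exists ((n%:~R - 1)^-1 *: q).
  rewrite /w qE map_mxZ kn; congr (_ *: _).
  by rewrite fmorphV rmorphB rmorph1 /= rmorph_int.
have [b0 [[[kb0 ib0] nb0] db0]] := filter_ex (filterI (filterI (filterI k2 kint) dint) dA).
pose C := cokermx M.
(* Two such points differ by a rational vector of [A], so by one in the row space of [M], the kernel
   of [C]. *)
have wM b : 2 <= kappa b -> kappa b \is a Num.int ->
    (kappa b - 1) *: x0 - delta b \is a mxOver Num.int -> (delta b <= A)%MS ->
    (w b - w b0) *m C = 0.
  move=> kb ib nb db; apply/eqP; rewrite -submxE; apply: EM; split.
    rewrite -[w b](subKr x0) -[w b0](subKr x0) !wE //.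
    rewrite opprD opprK addrACA subrr add0r addrC.
    by apply: addmx_sub; rewrite ?eqmx_opp scalemx_sub.
  have [q qE] := wQ _ ib nb; have [q0 q0E] := wQ _ ib0 nb0.
  by exists (q - q0); rewrite map_mxB qE q0E.
(* [w b] tends to [x0], and [(x0 - w b) *m C] does not depend on [b]. *)
have x0w : (x0 - w b0) *m C = 0.
  apply/rowP => j; rewrite [RHS]mxE; apply/eqP/negPn/negP => nz.
  rewrite -normr_gt0 in nz; have [e e0 eC] := mulmx_entries_lt C nz.
  have [b [[[[kb ib] nb] db] sb]] := filter_ex (filterI (filterI (filterI
    (filterI k2 kint) dint) dA) (dsmall _ e0)).
  suff : entries_lt e (x0 - w b).
    move=> /eC/(_ j); suff -> : (x0 - w b) *m C = (x0 - w b0) *m C by rewrite ltxx.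
    apply/eqP; rewrite -subr_eq0 -mulmxBl opprB addrC addrA subrK.
    by rewrite -(opprB (w b)) mulNmx wM // oppr0.
  move=> i; rewrite wE // mxE normrM; apply: le_lt_trans (sb i).
  have k0 : 0 < kappa b - 1 by move: kb; lra.
  by rewrite ler_piMl // normfV (gtr0_norm k0) invf_le1 //; move: kb; lra.
have CQ : C = map_mx ratr (cokermx Q) by rewrite /C MQ map_cokermx.
have [q0 q0E] := wQ _ ib0 nb0.
(* [m1] clears the denominators of [C] and [m2] those of [w b0 *m C], which equals [x0 *m C]. So the
   entries of [(n%:R *: x0 - N) *m C] are multiples of [(m1 * m2)^-1], and vanish once smaller than
   it. *)
have [m1 m1_gt0 m1C] := ratr_mx_denominator R (cokermx Q).
have [m2 m2_gt0 m2w] := ratr_mx_denominator R (q0 *m cokermx Q).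
have m_gt0 : 0 < (m1 * m2)%:R^-1 :> R by rewrite invr_gt0 ltr0n muln_gt0 m1_gt0.
have [e e0 eC] := mulmx_entries_lt C m_gt0.
exists e => // n N Nint /eC small; apply: submx_trans MA; rewrite submxE -/C.
have gC : (n%:R *: x0 - N) *m C = n%:R *: (w b0 *m C) - N *m C.
  by rewrite -[x0](subrK (w b0)) scalerDr mulmxBl mulmxDl -!scalemxAl x0w scaler0 add0r.
have mint : (m1 * m2)%:R *: ((n%:R *: x0 - N) *m C) \is a mxOver Num.int.
  rewrite gC scalerBr; apply: mxOver_intB.
    have -> : (m1 * m2)%:R *: (n%:R *: (w b0 *m C)) =
        (m1 * n)%:R *: (m2%:R *: map_mx ratr (q0 *m cokermx Q)).
      by rewrite q0E CQ -map_mxM !scalerA -!natrM mulnAC.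
    by apply: mxOverZ; [exact: natr_int | exact: m2w].
  have -> : (m1 * m2)%:R *: (N *m C) = m2%:R *: (N *m (m1%:R *: C)).
    by rewrite -scalemxAr scalerA -natrM mulnC.
  apply: mxOverZ; first exact: natr_int.
  by apply: mxOverM Nint _; rewrite CQ; exact: m1C.
apply/eqP/rowP => j; rewrite [RHS]mxE.
have m0 : 0 < (m1 * m2)%:R :> R by rewrite ltr0n muln_gt0 m1_gt0.
apply: (mulfI (lt0r_neq0 m0)); rewrite mulr0; apply: int_norm_lt1.
  by move/mxOverP: mint => /(_ 0 j); rewrite mxE.
by rewrite normrM normr_nat mulrC -ltr_pdivlMr // mul1r small.
Qed.

(** * Simultaneous approximation along IP sets *)

(** Pigeonhole: the cube is cut into boxes of side [M%:R^-1 < e], and one more point is taken than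
    there are boxes. *)
Lemma near_return (R : realType) (d : nat) (x0 : 'rV[R]_d) (s : nat -> nat) (e : R) :
  0 < e -> exists i j : nat, (i < j)%N /\ exists2 N : 'rV[R]_d,
    N \is a mxOver Num.int & entries_lt e ((s j)%:R *: x0 - (s i)%:R *: x0 - N).
Proof.
move=> e0; pose M := (Num.truncn e^-1).+1.
have M0 : 0 < M%:R :> R by rewrite ltr0n.
have Me : M%:R^-1 < e.
  have ei0 : 0 <= e^-1 by rewrite invr_ge0 ltW.
  by rewrite invf_plt ?posrE //; have /andP[] := truncn_itv ei0.
pose fr (t : R) := t - (Num.floor t)%:~R.
have fr0 t : 0 <= fr t by rewrite subr_ge0 floor_le.
have fr1 t : fr t < 1 by rewrite ltrBlDr addrC; have := floorD1_gt t; rewrite intrD.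
pose box (i : 'I_(#|{ffun 'I_d -> 'I_M}|.+1)) : {ffun 'I_d -> 'I_M} :=
  [ffun c => inord (Num.truncn (M%:R * fr ((s i)%:R * x0 0 c)))].
have boxE i c : (box i c)%:R <= M%:R * fr ((s i)%:R * x0 0 c) < (box i c).+1%:R.
  have h : 0 <= M%:R * fr ((s i)%:R * x0 0 c) by rewrite mulr_ge0 ?ler0n ?fr0.
  rewrite ffunE inordK; first exact: truncn_itv.
  by rewrite truncn_lt_nat // gtr_pMr.
have /injectivePn[i [j ij bij]] : ~~ injectiveb box.
  apply/negP => /injectiveP/leq_card; by rewrite card_ord ltnn.
wlog lt_ij : i j ij bij / (i < j)%N.
  move=> h; have [|ji|/val_inj/eqP] := ltngtP i j; [exact: h| |by rewrite (negPf ij)].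
  by apply: (h j i) => //; rewrite eq_sym.
exists i, j; split => //.
exists (\row_c ((Num.floor ((s j)%:R * x0 0 c))%:~R - (Num.floor ((s i)%:R * x0 0 c))%:~R)).
  by apply/mxOverP => a c; rewrite mxE rpredB // intr_int.
move=> c; rewrite !mxE; apply: lt_trans Me.
have := boxE i c; have := boxE j c; rewrite bij /fr -natr1.
move: (box j c)%:R => b.
set fi := (Num.floor _)%:~R; set fj := (Num.floor ((s i)%:R * _))%:~R.
move=> /andP[bj1 bj2] /andP[bi1 bi2]; rewrite -[_^-1]mul1r ltr_pdivlMr //.
rewrite -[X in _ * X](gtr0_norm M0) -normrM.
by rewrite ltr_norml; apply/andP; split; lra.
Qed.

(** Applied to partial sums of the generators: the difference of two is a sum over an interval of
    indices, nonempty as [i < j]. *)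
Lemma IP_near_return (R : realType) (d : nat) (x0 : 'rV[R]_d) (B : set nat) (e : R) :
  IP B -> 0 < e -> exists2 n : nat, B n &
    exists2 N : 'rV[R]_d, N \is a mxOver Num.int & entries_lt e (n%:R *: x0 - N).
Proof.
move=> [a a_gt0 aB] e0; pose s j := (\sum_(0 <= i < j) a i)%N.
have [i [j [ij [N Ni sN]]]] := near_return x0 s e0.
pose n := (\sum_(i <= k < j) a k)%N.
have sE : s j = (s i + n)%N by rewrite /s (big_cat_nat (leq0n _) (ltnW ij)).
exists n.
  apply: aB; exists [fset k in index_iota i j]%fset.
    by apply/fset0Pn; exists i; rewrite !inE mem_index_iota leqnn.
  apply: perm_big; apply: uniq_perm; rewrite ?fset_uniq ?iota_uniq //.
  by move=> k; rewrite !inE.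
exists N => //; move: sN; congr entries_lt; congr (_ - _).
by rewrite -scalerBl sE natrD addrC addKr.
Qed.

(** * Ultrafilters and orbits modulo integral vectors *)

Lemma ultra_seq_pick (T : Type) (I : eqType) (F : set_system T) (FU : UltraFilter F)
    (P : I -> set T) (s : seq I) :
  F [set x | exists2 i, i \in s & P i x] -> exists2 i, i \in s & F (P i).
Proof.
elim: s => [F0|i s IHs Fs].
  by have [x []] := filter_ex F0.
have [FP|FnP] := in_ultra_setVsetC (P i) FU.
  by exists i => //; exact: mem_head.
have [|j js FPj] := IHs; last by exists j => //; rewrite inE js orbT.
apply: filterS2 Fs FnP => x /= [j]; rewrite inE => /orP[/eqP -> //|js Pj _].
by exists j.
Qed.

(** Were [q] principal at [0], its translates would fill [betaN]; but the other ultrafilters form a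
    smaller left ideal, since [n + m = 0] forces [m = 0]. *)
Lemma minimal_ultrafilter_nonzero (q : betaN) :
  minimal_ultrafilter q -> \forall n \near betaN_sets q, (0 < n)%N.
Proof.
move=> [[[q0 Lq0] _] qmin].
have [q_0|] := in_ultra_setVsetC [set 0%N] (betaN_ultra q); last first.
  by apply: (@filterS _ (betaN_sets q)) => n /=; rewrite lt0n => n0; apply/eqP.
have addq r : betaN_add r q = r.
  apply: betaN_ext => E; split.
    apply: (@filterS _ (betaN_sets r)) => n nE.
    by have [_ [/= -> ]] := @filter_ex _ (betaN_sets q) _ _ (filterI q_0 nE); rewrite addn0.
  apply: (@filterS _ (betaN_sets r)) => n nE /=.
  by apply: (@filterS _ (betaN_sets q)) q_0 => _ ->; rewrite addn0.
pose L := [set p : betaN | ~ betaN_sets p [set 0%N]].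
have LL : left_ideal L.
  split.
    exists (BetaN (principal_filter_ultra 1%N)).
    by move=> /principal_filterP.
  move=> p l nl pl0; apply: nl.
  have [n] := @filter_ex _ (betaN_sets p) _ _ pl0.
  apply: (@filterS _ (betaN_sets l)) => m /= /eqP; rewrite addn_eq0 => /andP[_ /eqP] //.
have Lq : L = betaN_translate q.
  by apply: qmin => // p _; exists p.
by have : L q by rewrite Lq; exists q.
Qed.

Lemma kpow_orbit_near_lim (R : realType) (d k : nat) (x0 : 'rV[R]_d) (p : betaN) (e : R) :
  0 < e -> \forall n \near betaN_sets p,
    entries_lt e (kpow_orbit k x0 n - kpow_orbit_lim k x0 p).
Proof.
move=> e0; have := @kpow_orbit_is_cvg R d k x0 p; rewrite -/(kpow_orbit_lim k x0 p).
move=> /(_ _ (nbhsx_ballx _ _ e0)).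
apply: (@filterS _ (betaN_sets p)) => n /= [_ ball_n] i.
by rewrite mxE [X in _ + X]mxE distrC; exact: ball_n.
Qed.

Lemma frac_part_int (R : realType) (d : nat) (y : 'rV[R]_d) :
  y - frac_part y \is a mxOver Num.int.
Proof. by apply/mxOverP => i j; rewrite !mxE subKr intr_int. Qed.

Lemma frac_part_unique (R : realType) (d : nat) (y z : 'rV[R]_d) :
  unit_cube R d z -> y - z \is a mxOver Num.int -> frac_part y = z.
Proof.
move=> zc /mxOverP yz; apply/rowP => i; rewrite !mxE.
have := yz 0 i; rewrite !mxE => /intrP[n yzn].
have /andP[z0 z1] := zc i.
have -> : Num.floor (y 0 i) = n.
  by apply: floor_def; rewrite intrD -yzn; apply/andP; split; lra.
by rewrite -yzn; ring.
Qed.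

Lemma kpow_orbitD_int (R : realType) (d k : nat) (x0 : 'rV[R]_d) (a b : nat) :
  kpow_orbit k x0 (a + b) - (k ^ a)%:R *: kpow_orbit k x0 b \is a mxOver Num.int.
Proof.
have -> : kpow_orbit k x0 (a + b) - (k ^ a)%:R *: kpow_orbit k x0 b =
  (k ^ a)%:R *: ((k ^ b)%:R *: x0 - kpow_orbit k x0 b) -
  ((k ^ (a + b))%:R *: x0 - kpow_orbit k x0 (a + b)).
  move: (kpow_orbit _ _ b) (kpow_orbit _ _ _) => u v.
  by apply/rowP => i; rewrite !mxE expnD natrM; ring.
apply: mxOver_intB; last exact: frac_part_int.
by apply: mxOverZ; [exact: natr_int | exact: frac_part_int].
Qed.

Lemma meval_pos_near (R : realType) (d : nat) (gs : seq (mpoly d R)) (y0 : 'rV[R]_d) :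
  (forall g, g \in gs -> 0 < meval (fun i => y0 0 i) g) ->
  nbhs y0 [set y : 'rV[R]_d | forall g, g \in gs -> 0 < meval (fun i => y 0 i) g].
Proof.
elim: gs => [_|g gs IHgs gs_gt0].
  by apply: (@filterE _ (nbhs y0) (nbhs_filter y0)) => y g.
have [D [w gE]] := meval_box_monomials g.
have g_gt0 := gs_gt0 g (mem_head _ _); rewrite gE in g_gt0.
have near_g := @box_monomials_continuous R d D w y0 _
  (open_nbhs_nbhs (conj (@open_gt _ 0) g_gt0)).
have near_gs := IHgs (fun h hgs => gs_gt0 h (mem_behead (s := g :: gs) hgs)).
apply: (@filterS2 _ (nbhs y0) (nbhs_filter y0) _ _ _ _ near_g near_gs) => y gy gsy h.
by rewrite inE => /orP[/eqP ->|/gsy //]; rewrite gE.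
Qed.

(** * The orbit along [q] and a relatively interior point of [S] *)

Section Main.
Variables (R : realType) (d k : nat) (x0 : 'rV[R]_d) (q : betaN).
Hypotheses (k_ge2 : (2 <= k)%N) (q_idem : idempotent_ultrafilter q).
Hypotheses (q_min : minimal_ultrafilter q) (x0_lim : kpow_orbit_lim k x0 q = x0).

Let F := betaN_sets q.
Let delta b := kpow_orbit k x0 b - x0.
Let kappa b : R := (k ^ b)%:R.

Let FF : ProperFilter F. Proof. by case: (betaN_ultra q). Qed.

Let FD (E : set nat) : F E -> \forall b \near F, \forall c \near F, E (b + c)%N.
Proof. by rewrite /F -{1}q_idem. Qed.

Let kappa_gt0 b : 0 < kappa b.
Proof. by rewrite ltr0n expn_gt0 (leq_trans _ k_ge2). Qed.

Let kappa_ge2 : \forall b \near F, 2 <= kappa b.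
Proof.
apply: filterS (minimal_ultrafilter_nonzero q_min) => b b0.
by rewrite ler_nat (leq_trans k_ge2) // -{1}[k]expn1 leq_pexp2l // (leq_trans _ k_ge2).
Qed.

Let delta_small (e : R) : 0 < e -> \forall b \near F, entries_lt e (delta b).
Proof. by move=> e0; have := @kpow_orbit_near_lim R d k x0 q e e0; rewrite x0_lim. Qed.

Let delta_int b : (kappa b - 1) *: x0 - delta b \is a mxOver Num.int.
Proof.
have := frac_part_int (kappa b *: x0); rewrite /delta -/(kpow_orbit k x0 b).
move: (kpow_orbit _ _ b) => u.
by congr (_ \is a _); apply/rowP => i; rewrite !mxE; ring.
Qed.

Let deltaD_int a b :
  kpow_orbit k x0 (a + b) - kpow_orbit k x0 a - kappa a *: delta b \is a mxOver Num.int.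
Proof.
have := mxOver_intD (kpow_orbitD_int k x0 a b) (frac_part_int (kappa a *: x0)).
rewrite /delta -/(kpow_orbit k x0 a) -/(kappa a).
move: (kpow_orbit _ _ b) (kpow_orbit _ _ a) (kpow_orbit _ _ _) => u v w.
by congr (_ \is a _); apply/rowP => i; rewrite !mxE; ring.
Qed.

(** The two sides differ by an integral vector whose entries are combinations of three terms below
    [3^-1]. As [c] is chosen after [b], the bound on [delta c] can absorb [kappa b]. *)
Let deltaD : \forall b \near F, \forall c \near F,
  delta (b + c)%N = delta b + kappa b *: delta c.
Proof.
have e3 : 0 < 3^-1 :> R by rewrite invr_gt0.
apply: filterS2 (FD (delta_small e3)) (delta_small e3) => b sbc sb.
have ek : 0 < 3^-1 / kappa b by rewrite divr_gt0.
apply: filterS2 sbc (delta_small ek) => c {}sbc sc.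
apply/rowP => i; apply/eqP; rewrite -subr_eq0; apply/eqP; apply: int_norm_lt1.
  have /mxOverP/(_ 0 i) := deltaD_int b c; congr (_ \is a _).
  by rewrite /delta !mxE; ring.
have := sbc i; have := sb i; have := sc i; rewrite ltr_pdivlMr //.
rewrite -[X in _ * X < _ -> _](gtr0_norm (kappa_gt0 b)) -normrM mulrC.
rewrite !ltr_norml !mxE.
move=> /andP[h1 h2] /andP[h3 h4] /andP[h5 h6].
by apply/andP; split; lra.
Qed.

(** The difference [kpow_orbit k x0 (a + b) - kappa a *: delta b] is constant modulo integral
    vectors and converges along [q], hence is constant for almost all [b]. *)
Let orbit_shift a : exists z, \forall b \near F,
  kpow_orbit k x0 (a + b) = z + kappa a *: delta b.
Proof.
have e4 : 0 < 4^-1 :> R by rewrite invr_gt0.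
have ek : 0 < 4^-1 / kappa a by rewrite divr_gt0.
(* Adding the principal ultrafilter at [a] to [q] expresses the limit in [b] as an orbit limit. *)
have := @kpow_orbit_near_lim R d k x0 (betaN_add (BetaN (principal_filter_ultra a)) q) _ e4.
set l := kpow_orbit_lim _ _ _ => /principal_filterP; rewrite -/F => near_l.
have [b1 [l1 s1]] := @filter_ex _ F _ _ (filterI near_l (delta_small ek)).
exists (kpow_orbit k x0 (a + b1) - kappa a *: delta b1).
apply: filterS2 near_l (delta_small ek) => b lb sb; apply/rowP => i; apply/eqP; rewrite -subr_eq0.
apply/eqP; apply: int_norm_lt1.
  have /mxOverP/(_ 0 i) := mxOver_intB (deltaD_int a b) (deltaD_int a b1).
  by congr (_ \is a _); rewrite !mxE; ring.
have scale_small c : entries_lt (4^-1 / kappa a) (delta c) -> `|kappa a * delta c 0 i| < 4^-1.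
  by move=> /(_ i); rewrite ltr_pdivlMr // normrM (gtr0_norm (kappa_gt0 a)) mulrC.
have := lb i; have := scale_small _ sb; have := l1 i; have := scale_small _ s1.
rewrite !ltr_norml !mxE.
move=> /andP[h1 h2] /andP[h3 h4] /andP[h5 h6] /andP[h7 h8].
by apply/andP; split; lra.
Qed.

Lemma semialgebraic_orbit_interior (p : betaN) (S : set 'rV[R]_d) :
  betaN_translate q p -> semialgebraic S ->
  (\forall n \near betaN_sets p, S (kpow_orbit k x0 n)) ->
  exists n : nat, exists2 e : R, 0 < e & forall (m : nat) (N : 'rV[R]_d),
    N \is a mxOver Num.int -> entries_lt e (m%:R *: x0 - N) ->
    S (kpow_orbit k x0 n + (m%:R *: x0 - N)).
Proof.
move=> [r _ <-] [cs SE] near_S.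
(* Since [p] is [r + q], some fixed [a] puts the orbit at [a + b] in [S] for q-almost all [b]. *)
have [a near_Sa] := @filter_ex _ (betaN_sets r) _ _ near_S.
have [z zE] := orbit_shift a.
(* The ultrafilter [q] selects a single basic piece of [S]. *)
have [c ccs Fc] : exists2 c, c \in cs &
    F [set b | basic_semialgebraic c (z + kappa a *: delta b)].
  apply: (ultra_seq_pick (betaN_ultra q)); rewrite -/F.
  by apply: filterS2 near_Sa zE => b /= + <-; rewrite SE.
have [A [AF minA]] := @filter_hull R d F _ delta.
have [b [[[E0 P0] bA] bE]] := @filter_ex _ F _ _ (filterI (filterI Fc AF) zE).
have kappa_int : \forall b \near F, kappa b \is a Num.int.
  by apply: filterE => ?; exact: natr_int.
have near_delta_int : \forall b \near F, (kappa b - 1) *: x0 - delta b \is a mxOver Num.int.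
  by apply: filterE => ?; exact: delta_int.
have [e1 e1_gt0 small_A] :=
  small_return_in_hull kappa_ge2 kappa_int near_delta_int delta_small AF.
have : nbhs (kpow_orbit k x0 (a + b)) [set y : 'rV[R]_d | forall g, g \in c.2 ->
    0 < meval (fun i => y 0 i) g].
  by rewrite bE; exact: meval_pos_near.
move=> /nbhs_entries_lt[e2 e2_gt0 pos].
(* [e1] forces the displacement into [A], where the equations persist; [e2] preserves the strict
   inequalities. *)
exists (a + b)%N, (Num.min e1 e2) => [|m N Ni small]; first by rewrite lt_min e1_gt0.
have vA : (m%:R *: x0 - N <= A)%MS.
  by apply: small_A => // i; apply: lt_le_trans (small i) _; rewrite ge_min lexx.
have vpos := pos (m%:R *: x0 - N) _.
rewrite SE; exists c => //; split; last first.
  by apply: vpos => i; apply: lt_le_trans (small i) _; rewrite ge_min lexx orbT.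
move=> f fc; rewrite bE -addrA.
have -> : kappa a *: delta b + (m%:R *: x0 - N) =
    kappa a *: (delta b + (kappa a)^-1 *: (m%:R *: x0 - N)).
  by rewrite [RHS]scalerDr scalerA mulfV ?scale1r // gt_eqF.
apply: (vanishing_on_hull FD kappa_ge2 deltaD delta_small minA); last first.
  by apply: addmx_sub => //; exact: scalemx_sub.
by apply: filterS Fc => b' [/(_ f fc)].
Qed.
End Main.

(** * Return times to [S] *)

Theorem theorem3p4 (R : realType) (d k : nat) (hd : (1 <= d)%N) (hk : (2 <= k)%N)
    (x0 : 'rV[R]_d) (hx0 : unit_cube R d x0)
    (q : betaN) (hqi : idempotent_ultrafilter q) (hqm : minimal_ultrafilter q)
    (p : betaN) (hp : betaN_translate q p)
    (S : set 'rV[R]_d) (hSc : S `<=` unit_cube R d)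
    (hSa : semialgebraic S)
    (hq : kpow_orbit_lim k x0 q = x0)
    (hpS : \forall n \near betaN_sets p, S (kpow_orbit k x0 n)) :
  IP_star_plus [set l : nat | (1 <= l)%N /\ S (frac_part (l%:R *: x0))].
Proof.
have [n [e e0 Se]] := semialgebraic_orbit_interior hk hqi hqm hq hp hSa hpS.
exists (- (k ^ n)%N%:Z) => B /(IP_near_return x0)/(_ e0)[m Bm [N Ni small]].
exists m; split => //; exists (m + k ^ n)%N; last by rewrite PoszD addrK.
split; first by rewrite addn_gt0 expn_gt0 (leq_trans _ hk) ?orbT.
(* The point of [S] lies in the unit cube and differs from [(m + k ^ n)%:R *: x0] by an integral
   vector, so it is its fractional part. *)
have Sm := Se _ _ Ni small; rewrite (frac_part_unique (hSc _ Sm)) //.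
have := mxOver_intD (frac_part_int ((k ^ n)%:R *: x0)) Ni.
rewrite -/(kpow_orbit k x0 n); move: (kpow_orbit _ _ _) => u.
by congr (_ \is a _); apply/rowP => i; rewrite !mxE natrD; ring.
Qed.
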